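(* Let $X$ be a set, let $\sigma\in S_X$, and let $P$ be the permutation rack $(X,s)$ with $s_x:=\sigma$ for all $x\in X$. Let $U_P$ be the set of GL-structures on $P$, and for $\mathtt{u}_1,\mathtt{u}_2\in U_P$ write $\mathtt{u}_1\sim\mathtt{u}_2$ if and only if $(P,\mathtt{u}_1)\cong(P,\mathtt{u}_2)$ as GL-racks. Then $U_P=C_{S_X}(\sigma)=\operatorname{Aut}P$, where $C_{S_X}(\sigma)$ is the centralizer of $\sigma$ in $S_X$, and $U_P/{\sim}$ is the set of conjugacy classes of the group $C_{S_X}(\sigma)$.
   Context: For a set $X$, $S_X$ is the group of permutations of $X$; products of maps denote composition. A rack is a pair $(X,s)$ of a set $X$ and a map $s:X\to S_X$, $x\mapsto s_x$, such that $s_xs_y=s_{s_x(y)}s_x$ for all $x,y\in X$. A rack homomorphism $(X,s)\to(Y,t)$ is a map $\varphi:X\to Y$ with $\varphi s_x=t_{\varphi(x)}\varphi$ for all $x\in X$. $\operatorname{Aut}R$ is the group of rack automorphisms of a rack $R$. A GL-structure on $R=(X,s)$ is an automorphism $\mathtt{u}\in\operatorname{Aut}R$ such that $\mathtt{u}s_x=s_x\mathtt{u}$ for all $x\in X$; the pair $(R,\mathtt{u})$ is called a GL-rack. A GL-rack homomorphism $(R_1,\mathtt{u}_1)\to(R_2,\mathtt{u}_2)$ is a rack homomorphism $\varphi$ with $\varphi\mathtt{u}_1=\mathtt{u}_2\varphi$; isomorphisms are bijective homomorphisms. *)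

(* Defs.v *)
From HB Require Import structures.
From mathcomp Require Import all_boot.
From mathcomp Require Import all_classical.

Set Implicit Arguments.
Unset Strict Implicit.
Unset Printing Implicit Defensive.

Local Open Scope classical_set_scope.
Local Open Scope group_scope.

(* MathComp's {perm T} needs a finite T, so the group of permutations of an
   arbitrary type is built here. *)
Record Sym (X : Type) := MkSym {
  sym_fun :> X -> X;
  sym_bij : bijective sym_fun
}.

Lemma symP (X : Type) (f g : Sym X) : (f = g :> (X -> X)) -> f = g.
Proof.
case: f g => [f fb] [g gb] /= fg; case: _ / fg gb => gb.
by congr MkSym; exact: Prop_irrelevance.
Qed.

HB.instance Definition _ (X : Type) := gen_eqMixin (Sym X).
HB.instance Definition _ (X : Type) := gen_choiceMixin (Sym X).

Section SymGroup.
Variable X : Type.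
Implicit Types f g h : Sym X.

Definition sym_one : Sym X := MkSym (Bijective (frefl id) (frefl id)).

Definition sym_mul f g : Sym X := MkSym (bij_comp (sym_bij f) (sym_bij g)).

Lemma sym_inv_subproof f : {g : Sym X | cancel f g /\ cancel g f}.
Proof.
apply: cid; have [g fK gK] := sym_bij f.
by exists (MkSym (Bijective gK fK)).
Qed.

Definition sym_inv f : Sym X := sval (sym_inv_subproof f).

Lemma sym_mulA : associative sym_mul.
Proof. by move=> f g h; apply: symP. Qed.

Lemma sym_mul1s : left_id sym_one sym_mul.
Proof. by move=> f; apply: symP. Qed.

Lemma sym_muls1 : right_id sym_one sym_mul.
Proof. by move=> f; apply: symP. Qed.

Lemma sym_mulVs : left_inverse sym_one sym_inv sym_mul.
Proof.
move=> f; apply: symP; apply: funext => x /=.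
by have [fK _] := svalP (sym_inv_subproof f); exact: fK.
Qed.

Lemma sym_mulsV : right_inverse sym_one sym_inv sym_mul.
Proof.
move=> f; apply: symP; apply: funext => x /=.
by have [_ fK] := svalP (sym_inv_subproof f); exact: fK.
Qed.

HB.instance Definition _ :=
  isGroup.Build (Sym X) sym_mulA sym_mul1s sym_muls1 sym_mulVs sym_mulsV.

End SymGroup.

Definition centralizer (G : groupType) (g : G) : set G :=
  [set h | commute g h].

(* For a subgroup C, conjugation is by elements of C only. *)
Definition conjugacy_classes (G : groupType) (C : set G) : set (set G) :=
  [set [set conjg g c | c in C] | g in C].

Definition quotient_set (T : Type) (A : set T) (r : T -> T -> Prop) :
    set (set T) :=
  [set [set b | A b /\ r a b] | a in A].

Record rack := MkRack {
  rack_sort :> Type;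
  rack_op : rack_sort -> Sym rack_sort;
  rack_opP : forall x y,
    rack_op x * rack_op y = rack_op (rack_op x y) * rack_op x
}.

Definition rack_hom (R S : rack) (f : R -> S) : Prop :=
  forall x : R, f \o rack_op x = rack_op (f x) \o f.

Definition rack_aut (R : rack) : set (Sym R) :=
  [set f | rack_hom (f : R -> R)].
Arguments rack_aut R : clear implicits.

Definition GL_structures (R : rack) : set (Sym R) :=
  [set u | rack_aut R u /\ forall x : R, u * rack_op x = rack_op x * u].
Arguments GL_structures R : clear implicits.

Record GLrack := MkGLrack {
  GL_rack :> rack;
  GL_map : Sym GL_rack;
  GL_mapP : GL_structures GL_rack GL_map
}.

Definition GLrack_hom (R S : GLrack) (f : R -> S) : Prop :=
  rack_hom f /\ f \o GL_map R = GL_map S \o f.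

Definition GLrack_isom (R S : GLrack) : Prop :=
  exists f : R -> S, bijective f /\ GLrack_hom f.

(* The relation is carried by Sym R; the existential proofs restrict it to
   GL_structures R. *)
Definition GL_equiv (R : rack) (u1 u2 : Sym R) : Prop :=
  exists (h1 : GL_structures R u1) (h2 : GL_structures R u2),
    GLrack_isom (MkGLrack h1) (MkGLrack h2).
Arguments GL_equiv R : clear implicits.

Lemma GLrack_isom_refl (R : GLrack) : GLrack_isom R R.
Proof. by exists id; split; [exists id | split]. Qed.

Lemma GLrack_isom_sym (R S : GLrack) : GLrack_isom R S -> GLrack_isom S R.
Proof.
move=> [f [[g fK gK] [fs fu]]]; exists g; split; first by exists f.
split=> [x|]; apply: funext => y /=; apply: (can_inj fK); rewrite gK.
- by have /= := congr1 (@^~ (g y)) (fs (g x)); rewrite !gK => ->.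
- by have /= := congr1 (@^~ (g y)) fu; rewrite !gK => ->.
Qed.

Lemma GLrack_isom_trans (R S T : GLrack) :
  GLrack_isom R S -> GLrack_isom S T -> GLrack_isom R T.
Proof.
move=> [f [fb [fs fu]]] [g [gb [gs gu]]]; exists (g \o f).
split; first exact: bij_comp.
split=> [x|]; apply: funext => y /=.
- have /= -> := congr1 (@^~ y) (fs x).
  by have /= -> := congr1 (@^~ (f y)) (gs (f x)).
- have /= -> := congr1 (@^~ y) fu.
  by have /= -> := congr1 (@^~ (f y)) gu.
Qed.

Lemma GL_equiv_refl (R : rack) (u : Sym R) :
  GL_structures R u -> GL_equiv R u u.
Proof. by move=> hu; exists hu, hu; exact: GLrack_isom_refl. Qed.

Lemma GL_equiv_sym (R : rack) (u v : Sym R) :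
  GL_equiv R u v -> GL_equiv R v u.
Proof. by move=> [hu [hv /GLrack_isom_sym ?]]; exists hv, hu. Qed.

Lemma GL_equiv_trans (R : rack) (u v w : Sym R) :
  GL_equiv R u v -> GL_equiv R v w -> GL_equiv R u w.
Proof.
move=> [hu [hv uv]] [hv' [hw vw]]; exists hu, hw.
by rewrite (Prop_irrelevance hv' hv) in vw; exact: GLrack_isom_trans uv vw.
Qed.

Definition permutation_rack (X : Type) (sigma : Sym X) : rack :=
  @MkRack X (fun=> sigma) (fun _ _ => erefl).

(* Main.v *)
(** For a permutation rack the automorphism condition on [f] reads
    [f sigma = sigma f], and the GL-condition repeats it. An isomorphism
    [f : (P, u) -> (P, v)] is then a permutation centralizing [sigma] with
    [f u = v f], so that [v] is the conjugate of [u] by [f^-1]. *)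
Require Import Defs.
From mathcomp Require Import all_boot.
From mathcomp Require Import all_classical.

Set Implicit Arguments.
Unset Strict Implicit.
Unset Printing Implicit Defensive.

Local Open Scope classical_set_scope.
Local Open Scope group_scope.

(** Bridge between homomorphism conditions, stated on maps, and group equations: products unfold to
    compositions, and [symP] discards the bijectivity proofs. *)
Lemma sym_mulP (X : Type) (f g h k : Sym X) :
  f * g = h * k <-> f \o g = h \o k :> (X -> X).
Proof.
split=> [fghk|fghk]; first exact: (congr1 (@sym_fun X) fghk).
exact: (@symP X (f * g) (h * k)).
Qed.

(* The rack condition quantifies over points, so it is vacuous when [X] is
   empty, where all maps agree anyway. *)
Lemma rack_hom_permutation (X : Type) (sigma f : Sym X) :
  @rack_hom (permutation_rack sigma) (permutation_rack sigma) f <->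
  commute sigma f.
Proof.
split=> [fhom|/sym_mulP fC x]; last exact: esym fC.
(* The argument [x] also serves as the point indexing the rack condition. *)
by apply/sym_mulP/funext => x; exact: (congr1 (@^~ x) (esym (fhom x))).
Qed.

Lemma rack_aut_permutation (X : Type) (sigma : Sym X) :
  rack_aut (permutation_rack sigma) = centralizer sigma.
Proof. by apply/seteqP; split=> f /rack_hom_permutation. Qed.

Lemma GL_structures_permutation (X : Type) (sigma : Sym X) :
  GL_structures (permutation_rack sigma) = centralizer sigma.
Proof.
rewrite -rack_aut_permutation; apply/seteqP; split=> u; first by case.
by move=> uaut; split=> // x; apply/esym/rack_hom_permutation.
Qed.

(** The left side is membership of [v] in the class of [u] as [quotient_set] forms it. *)
Lemma GL_equiv_permutation (X : Type) (sigma u v : Sym X) :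
  centralizer sigma u ->
  (centralizer sigma v /\ GL_equiv (permutation_rack sigma) u v) <->
  exists2 c, centralizer sigma c & conjg u c = v.
Proof.
move=> uC; split=> [[vC [uG [vG [f [fbij [fhom fu]]]]]]|[c cC <-]].
- pose F : Sym X := MkSym fbij.
  have FC : commute sigma F by apply/rack_hom_permutation.
  have Fu : F * u = v * F := (sym_mulP F u v F).2 fu.
  (* [conjg u c] is [c^-1 * (u * c)], so [F * u * F^-1] conjugates by [F^-1]; conversely [c] yields
     the isomorphism [c^-1]. *)
  exists F^-1; first exact: commuteV.
  by rewrite /conjg invgK mulgA Fu mulgK.
- have vC : centralizer sigma (conjg u c).
    by apply: commuteM; [exact: commuteV | exact: commuteM].
  split=> //.
  have uG : GL_structures (permutation_rack sigma) u.
    by rewrite GL_structures_permutation.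
  have vG : GL_structures (permutation_rack sigma) (conjg u c).
    by rewrite GL_structures_permutation.
  exists uG, vG, (c^-1 : Sym X); split; first exact: sym_bij.
  split; first by apply/rack_hom_permutation; exact: commuteV.
  have /sym_mulP // : c^-1 * u = conjg u c * c^-1.
  by rewrite /conjg mulgA mulgK.
Qed.

Theorem proposition4p3 (X : Type) (sigma : Sym X) :
  [/\ GL_structures (permutation_rack sigma) = centralizer sigma,
      centralizer sigma = rack_aut (permutation_rack sigma)
    & quotient_set (GL_structures (permutation_rack sigma))
                   (GL_equiv (permutation_rack sigma))
      = conjugacy_classes (centralizer sigma)].
Proof.
split; [exact: GL_structures_permutation | by rewrite rack_aut_permutation |].
(* Both sets of classes are images of the centralizer, so it is enough to match the two classes of
   each [u]. *)
rewrite GL_structures_permutation; apply: eq_imagel => u uC.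
by apply/seteqP; split=> v /(GL_equiv_permutation _ uC).
Qed.
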